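(* Let $0<\alpha<1$, $1<p<\frac1\alpha$, $\frac1q=\frac1p-\alpha$ and $q<2p$. Set $s=\frac{qp}{2p-q}$ and let $\omega\in\mathcal{A}(p,q)$. Then the discrete fractional maximal operator $\mathcal{M}_\alpha$ is bounded from $l^p_{q\,(\omega^p,\omega^q)}$ to $l^q_{s\,(\omega^q,\omega^q)}$; that is, there is a positive constant $C$ with $\|\mathcal{M}_\alpha x\|_{l^q_{s\,(\omega^q,\omega^q)}}\le C\|x\|_{l^p_{q\,(\omega^p,\omega^q)}}$ for all $x\in l^p_{q\,(\omega^p,\omega^q)}$.
   Context: Sequences are real, $x=\{x(k)\}_{k\in\mathbb{Z}}\subset\mathbb{R}$. $\mathbb{N}=\{0,1,2,\dots\}$. For $m\in\mathbb{Z}$, $N\in\mathbb{N}$, $S_{m,N}:=\{k\in\mathbb{Z}:|k-m|\le N\}$; $|A|$ denotes cardinality. A discrete weight is a sequence $\omega=\{\omega(k)\}_{k\in\mathbb{Z}}$ of positive reals; powers $\omega^r$ are pointwise; for finite $A\subset\mathbb{Z}$, $\omega(A):=\sum_{k\in A}\omega(k)$. Discrete weighted Morrey space: for $1\le p\le q<\infty$ and weights $u,v$, $l^p_{q\,(u,v)}$ is the space of sequences with $$\|x\|_{l^p_{q\,(u,v)}}:=\sup_{m\in\mathbb{Z},N\in\mathbb{N}}\big(v(S_{m,N})\big)^{\frac1q-\frac1p}\Big(\sum_{k\in S_{m,N}}|x(k)|^pu(k)\Big)^{\frac1p}<\infty .$$ An interval $J\subset\mathbb{Z}$ is a finite nonempty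 set of consecutive integers. For $1<p,q<\infty$ and $p'=p/(p-1)$, $\omega\in\mathcal{A}(p,q)$ means $$\sup_{J}\Big(\frac1{|J|}\sum_{k\in J}\omega(k)^q\Big)^{\frac1q}\Big(\frac1{|J|}\sum_{k\in J}\omega(k)^{-p'}\Big)^{\frac1{p'}}<\infty,$$ the supremum being over all intervals $J\subset\mathbb{Z}$. Discrete fractional maximal operator: $\mathcal{M}_\alpha x(m):=\sup_{N\in\mathbb{N}}\frac{1}{|S_{m,N}|^{1-\alpha}}\sum_{k\in S_{m,N}}|x(k)|$, $m\in\mathbb{Z}$. *)

(* Defs.v *)
From HB Require Import structures.
From mathcomp Require Import all_boot all_order all_algebra finmap.
From mathcomp Require Import all_classical all_reals all_analysis.

From mathcomp Require Import zify.

Set Implicit Arguments.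
Unset Strict Implicit.
Unset Printing Implicit Defensive.

Import Order.TTheory GRing.Theory Num.Theory.

Local Open Scope classical_set_scope.
Local Open Scope ring_scope.

Definition dball (m : int) (N : nat) : set int := [set k | `|k - m| <= N%:Z].

Lemma dballE (m : int) (N : nat) : dball m N = `[m - N%:Z, m + N%:Z]%classic.
Proof.
by apply/seteqP; split=> k; rewrite /dball /= in_itv /= ler_distl.
Qed.

Lemma finite_int_itv (a b : int) : finite_set `[a, b]%classic.
Proof.
pose f (i : nat) : int := a + i%:Z.
apply: (@sub_finite_set _ _ (f @` `I_(`|b - a|.+1))); last first.
  exact: finite_image.
move=> k /=; rewrite in_itv /= => /andP[ak kb].
exists `|k - a|%N; first by rewrite /=; lia.
by rewrite /f; lia.
Qed.

Lemma finite_dball (m : int) (N : nat) : finite_set (dball m N).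
Proof. by rewrite dballE; exact: finite_int_itv. Qed.

Definition int_interval (J : set int) : Prop :=
  exists a b : int, a <= b /\ J = `[a, b]%classic.

(* This is |A| only for finite A (otherwise fset_set A is empty). *)
Definition cardR (R : realType) (A : set int) : R := #|` fset_set A|%:R.

Definition is_weight (R : realType) (w : int -> R) : Prop :=
  forall k, 0 < w k.

Definition wpow (R : realType) (w : int -> R) (r : R) : int -> R :=
  fun k => w k `^ r.

(* A sum over \in is 0 when the support is infinite; all sets used here are finite. *)
Definition wsum (R : realType) (w : int -> R) (A : set int) : R :=
  \sum_(k \in A) w k.

(* The argument is extended-real-valued because the fractional maximal
   function of a real sequence may a priori take the value +oo. *)
Definition morrey_norm (R : realType) (p q : R) (u v : int -> R)
    (x : int -> \bar R) : \bar R :=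
  ereal_sup (range (fun mN : int * nat =>
    (((wsum v (dball mN.1 mN.2)) `^ (q^-1 - p^-1))%:E *
     poweR (\sum_(k \in dball mN.1 mN.2) (poweR `|x k| p * (u k)%:E))
           p^-1)%E)).

Definition morrey (R : realType) (p q : R) (u v : int -> R) :
    set (int -> R) :=
  [set x | (morrey_norm p q u v (EFin \o x) < +oo)%E].

Definition conj_exp (R : realType) (p : R) : R := p / (p - 1).

Definition Apq (R : realType) (p q : R) (w : int -> R) : Prop :=
  (ereal_sup [set
     (((cardR R J)^-1 * wsum (wpow w q) J) `^ q^-1 *
      ((cardR R J)^-1 * wsum (wpow w (- conj_exp p)) J) `^ (conj_exp p)^-1)%:E
     | J in int_interval] < +oo)%E.

Definition frac_maximal (R : realType) (alpha : R) (x : int -> R) (m : int) :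
    \bar R :=
  ereal_sup (range (fun N : nat =>
    ((cardR R (dball m N) `^ (1 - alpha))^-1 *
     \sum_(k \in dball m N) `|x k|)%:E)).

(* Main.v *)
(* Write [u = w^q], [sg = w^(-p')], [r = 1 + q/p' = q (1 - alpha)], so that [u = sg^(1-r)]
   and A(p,q) is the A_r condition [u(J)/|J| (sg(J)/|J|)^(r-1) <= B].
   Fix [S = S_{m,N}].  Balls of radius [N' <= 2N] around points of [S] lie in [S_{m,3N}].
   For an interval [J] there, with [g = |x|/sg], [G^p] the sum of [|x|^p w^p]
   over [S_{m,3N}], [x(J)] that of [|x|] over [J], and [r' = r/(r-1)],
   Hölder's inequality and A_r give (Lerner's argument)
     [(|J|^(alpha-1) x(J))^q <= B^r' G^(q-p) (|J|/u(J))^r' (M_sg g (y))^p  for all y in J];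
   taking the power [1/r'] and averaging over [y] in [J], the left-hand side is at most
   [B^r' G^(q-p) (M_u ((M_sg g)^(p/r') / u))^r'].  The maximal operators [M_sg] and [M_u] with
   respect to a measure are bounded on every [L^t], [t > 1], with constants independent
   of the measure, whence the strong (p,q) bound; A_r makes [u] doubling.
   For [N' > 2N], Hölder on [S_{m,N+N'}], A_r and the Morrey norm bound the average by a
   multiple of [u(S_{m,N+N'})^(alpha-1/q) <= u(S)^(alpha-1/q)]. *)
Require Import Defs.
From HB Require Import structures.
From mathcomp Require Import all_boot all_order all_algebra finmap.
From mathcomp Require Import all_classical all_reals all_analysis.
From mathcomp Require Import zify lra.

Import Order.TTheory GRing.Theory Num.Theory.

Local Open Scope classical_set_scope.
Local Open Scope ring_scope.

(** * Maximal functions with respect to an arbitrary positive measure on a range of indices *)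

Section UniversalMaximal.
Context {R : realType}.
Implicit Types (p q t lam : R) (f g mu c : nat -> R).

(* Garsia's argument: the good indices collect at least as much mass as any
   prefix does, by downward induction on its left end. *)
Lemma maximal_ergodic g (n : nat) (P : pred nat) :
  (forall k, P k <-> exists2 j, (k < j <= n)%N & 0 <= \sum_(k <= l < j) g l) ->
  0 <= \sum_(0 <= l < n | P l) g l.
Proof.
move=> HP.
suff H d k j : (n - k <= d)%N -> (k <= j <= n)%N ->
    \sum_(k <= l < j) g l <= \sum_(k <= l < n | P l) g l.
  by have := H n 0%N 0%N (leq_subr _ _) (leq0n _); rewrite [leLHS]big_geq.
elim: d k j => [|d IH] k j dn kjn.
  by rewrite [leLHS]big_geq ?[leRHS]big_geq //; lia.
have [kn|nk] := leqP n k.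
  by rewrite [leLHS]big_geq ?[leRHS]big_geq //; lia.
have IHk i : (k < i <= n)%N ->
  \sum_(k.+1 <= l < i) g l <= \sum_(k.+1 <= l < n | P l) g l.
  by move=> ?; apply: IH; lia.
rewrite [leRHS]big_ltn_cond //.
have [Pk|Pk] := boolP (P k).
  have step i : (k < i <= n)%N ->
    \sum_(k <= l < i) g l <= g k + \sum_(k.+1 <= l < n | P l) g l.
    by move=> ki; rewrite big_ltn; [rewrite lerD2l IHk | lia].
  (* For [j <= k] the left side is an empty sum; a good [k] starts some nonnegative sum, and [step]
     for that sum shows that the right side is nonnegative. *)
  have [kj|jk] := ltnP k j; first by apply: step; lia.
  have /HP[i ki i0] := Pk; rewrite [leLHS]big_geq //=.
  exact: le_trans i0 (step i ki).
have H0 : 0 <= \sum_(k.+1 <= l < n | P l) g l.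
  by have := IHk k.+1; rewrite ltnSn nk [leLHS]big_geq //; exact.
have [kj|jk] := ltnP k j; last by rewrite [leLHS]big_geq.
apply: le_trans H0; rewrite leNgt; apply: contra Pk => /ltW sg.
by apply/HP; exists j => //; lia.
Qed.

Lemma le_sum_subrange g (i j i1 j1 : nat) :
  (forall l, 0 <= g l) -> (i <= i1)%N -> (i1 <= j1)%N -> (j1 <= j)%N ->
  \sum_(i1 <= l < j1) g l <= \sum_(i <= l < j) g l.
Proof.
move=> g0 ii ij jj.
rewrite [leRHS](@big_cat_nat _ _ _ i1) //=; last by lia.
rewrite [X in _ <= _ + X](@big_cat_nat _ _ _ j1) //=.
rewrite ler_wpDl ?ler_wpDr //; exact: sumr_ge0.
Qed.

(** Young's inequality for [a^(p-1)] and [b] with exponents [p/(p-1)] and [p], multiplied by [p]. *)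
Lemma powR_young p (a b : R) : 1 < p -> 0 <= a -> 0 <= b ->
  p * (a `^ (p - 1) * b) <= (p - 1) * a `^ p + b `^ p.
Proof.
move=> p1 a0 b0.
have p10 : 0 < p - 1 by lra.
have p0 : 0 < p by lra.
have pV : p * p^-1 = 1 by rewrite divff //; lra.
have := @conjugate_powR R (a `^ (p - 1)) b (p / (p - 1)) p
  (powR_ge0 _ _) b0 (divr_gt0 p0 p10) p0.
rewrite -powRrM mulrCA divff ?mulr1; last by lra.
rewrite invf_div mulrBl mul1r pV subrK => /(_ erefl) /(ler_wpM2l (ltW p0)).
rewrite mulrBr mulr1 mulrDr mulrBr ![p * (_ / p)]mulrCA pV !mulr1.
lra.
Qed.

(** Replaces the integration over [[a, b]] of [p t^(p-1) <= b p t^(p-2)]; multiplied by [p - 1] it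
    rearranges to [powR_young]. *)
Lemma powR_gap p (a b : R) : 1 < p -> 0 <= a -> 0 <= b ->
  b `^ p - a `^ p <= p / (p - 1) * (b `^ (p - 1) - a `^ (p - 1)) * b.
Proof.
move=> p1 a0 b0.
have p10 : 0 < p - 1 by lra.
rewrite [p / _]mulrC -!mulrA ler_pdivlMl //.
rewrite [(_ - _) * b]mulrBl [_ * b]mulrC mulr_powRB1 //; last by lra.
by have := powR_young p a b p1 a0 b0; lra.
Qed.

(* An Abel summation in the values of [c], replacing the layer-cake integral. *)
Lemma weak_to_strong (I : finType) p (f c mu : I -> R) :
  1 < p -> (forall i, 0 <= f i) -> (forall i, 0 <= c i) ->
  (forall i, 0 <= mu i) ->
  (forall lam, 0 < lam ->
    lam * \sum_(i | lam <= c i) mu i <= \sum_(i | lam <= c i) f i * mu i) ->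
  \sum_i c i `^ p * mu i <= (p / (p - 1)) `^ p * \sum_i f i `^ p * mu i.
Proof.
move=> p1 f0 c0 mu0 weak.
have p10 : 0 < p - 1 by lra.
have p0 : 0 < p by lra.
set p' := p / (p - 1).
have p'0 : 0 < p' by exact: divr_gt0.
(* The claim is generalised to a threshold [t] and proved by induction on the number of indices
   whose value exceeds [t]; the case [t = 0] is the one wanted. *)
have abel (n : nat) (t : R) : (#|[pred i | (t < c i)%R]| <= n)%N -> 0 <= t ->
  0 <= \sum_(i | t < c i)
    (p' * (c i `^ (p - 1) - t `^ (p - 1)) * f i - (c i `^ p - t `^ p)) * mu i.
  elim: n t => [|n IH] t; rewrite ?leqn0.
    move=> /eqP/card0_eq E t0; rewrite big1 // => i ti.
    by have := E i; rewrite inE ti.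
  move=> cn t0.
  case: (pickP (fun i => t < c i)) => [i0 /= ti0|E]; last first.
    by rewrite big1 // => i ti; have := E i; rewrite /= ti.
  pose im := [arg min_(i < i0 | t < c i) c i]%O.
  have [tim mini] : t < c im /\ forall i, t < c i -> c im <= c i.
    by rewrite /im; case: arg_minP.
  set b := c im.
  have tb : (fun i => t < c i) =1 (fun i => b <= c i).
    move=> i; apply/idP/idP; first exact: mini.
    exact: lt_le_trans.
  have b0 : 0 < b by exact: le_lt_trans tim.
  under eq_bigl do rewrite tb.
  (* Raising the threshold from [t] to [b], the least value above [t], turns the summand into [A]
     plus an increment. The terms of [A] with [c i = b] vanish and the others fall under the
     induction hypothesis; the increments have a nonnegative sum by [powR_gap] and the weak
     inequality at level [b]. *)
  pose A i := (p' * (c i `^ (p - 1) - b `^ (p - 1)) * f i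
    - (c i `^ p - b `^ p)) * mu i.
  rewrite (eq_bigr (fun i => A i + (p' * (b `^ (p - 1) - t `^ (p - 1)) *
    (f i * mu i) - (b `^ p - t `^ p) * mu i))); last first.
    by move=> i _; rewrite /A; lra.
  rewrite big_split /= addr_ge0 //.
    rewrite (bigID (fun i => b < c i)) /= addr_ge0 //.
      rewrite (eq_bigl (fun i => b < c i)).
        apply: IH; last exact: ltW.
        rewrite -ltnS; apply: leq_trans cn; apply: proper_card.
        apply/properP; split.
          by apply/fintype.subsetP => i; rewrite !inE; apply: lt_trans.
        by exists im; rewrite !inE ?ltxx.
      by move=> i; case: (ltP b (c i)) => [/ltW -> //|]; rewrite andbF.
    rewrite big1 // => i /andP[bc]; rewrite -leNgt => cb.
    have cib : c i = b by apply/eqP; rewrite eq_le cb bc.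
    by rewrite /A cib !subrr mulr0 !mul0r subrr mul0r.
  rewrite sumrB -!mulr_sumr subr_ge0.
  have gap := powR_gap p t b p1 t0 (ltW b0).
  have K0 : 0 <= p' * (b `^ (p - 1) - t `^ (p - 1)).
    rewrite mulr_ge0 ?(ltW p'0) // subr_ge0 ge0_ler_powR ?nnegrE ?(ltW tim) //.
    exact: ltW.
    exact: ltW.
  apply: le_trans (ler_wpM2l K0 (weak b b0)).
  rewrite mulrA ler_wpM2r // sumr_ge0 //.
have H0 := abel _ 0 (leqnn _) (lexx 0).
have {}H0 : \sum_i c i `^ p * mu i <= \sum_i p' * (c i `^ (p - 1) * f i) * mu i.
  rewrite -subr_ge0 -sumrB; apply: le_trans H0 _.
  rewrite big_mkcond /=; apply: ler_sum => i _.
  case: ltP => ci.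
    rewrite !powR0 ?subr0; [|lra..].
    by rewrite le_eqVlt; apply/orP; left; apply/eqP; lra.
  have -> : c i = 0 by apply/eqP; rewrite eq_le ci c0.
  by rewrite !powR0; [rewrite !mul0r mulr0 mul0r subrr|lra..].
(* Applied to [c i] and [p' * f i], Young's inequality puts the coefficient [p - 1] before the sum
   of [c^p mu], which is then absorbed by [p] times the same finite sum. *)
have Y i : p * (p' * (c i `^ (p - 1) * f i) * mu i) <=
    (p - 1) * (c i `^ p * mu i) + p' `^ p * (f i `^ p * mu i).
  have := powR_young p (c i) (p' * f i) p1 (c0 i) (mulr_ge0 (ltW p'0) (f0 i)).
  by rewrite powRM ?(ltW p'0) // => /(ler_wpM2r (mu0 i)); lra.
have : p * \sum_i c i `^ p * mu i <= (p - 1) * (\sum_i c i `^ p * mu i) +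
   p' `^ p * \sum_i f i `^ p * mu i.
  apply: le_trans (ler_wpM2l (ltW p0) H0) _.
  rewrite !mulr_sumr -big_split /=.
  by apply: ler_sum => i _; exact: Y.
lra.
Qed.

(** [c k] is the largest average over an interval starting at [k]. Applying [maximal_ergodic] to
    [(f - lam) mu] gives the weak type inequality with constant 1, which [weak_to_strong]
    upgrades. *)
Lemma right_maximal p f mu (n : nat) :
  1 < p -> (forall k, 0 <= f k) -> (forall k, 0 < mu k) ->
  exists c, [/\ forall k, 0 <= c k,
    forall i j, (i < j <= n)%N ->
      \sum_(i <= l < j) f l * mu l <= c i * \sum_(i <= l < j) mu l &
    \sum_(0 <= l < n) c l `^ p * mu l <=
      (p / (p - 1)) `^ p * \sum_(0 <= l < n) f l `^ p * mu l].
Proof.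
move=> p1 f0 mu0.
pose avg k j := (\sum_(k <= l < j) f l * mu l) / \sum_(k <= l < j) mu l.
have den k j : (k < j)%N -> 0 < \sum_(k <= l < j) mu l.
  move=> kj; rewrite big_ltn //; apply: ltr_pwDl => //.
  by apply: sumr_ge0 => *; exact: ltW.
pose c k := \big[Num.max/0]_(j < n.+1 | (k < j)%N) avg k j.
have c0 k : 0 <= c k by exact: bigmax_ge_id.
have cP i j : (i < j <= n)%N -> avg i j <= c i.
  move=> /andP[ij jn].
  exact: (le_bigmax_cond _ (j := Ordinal (jn : (j < n.+1)%N))
    (P := fun j : 'I_n.+1 => (i < j)%N) (fun j : 'I_n.+1 => avg i j)).
exists c; split => //.
  by move=> i j ij; rewrite -ler_pdivrMr ?cP // den //; case/andP: ij.
rewrite !big_mkord; apply: weak_to_strong => // [i|lam lam0]; first exact: ltW.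
rewrite mulr_sumr -subr_ge0 -sumrB.
have := @maximal_ergodic (fun l => f l * mu l - lam * mu l) n
  (fun k => lam <= c k).
rewrite big_mkord; apply => k.
have E j : (k < j)%N ->
    (0 <= \sum_(k <= l < j) (f l * mu l - lam * mu l)) = (lam <= avg k j).
  by move=> kj; rewrite sumrB -mulr_sumr subr_ge0 ler_pdivlMr // den.
split=> [lc|[j kj]]; last first.
  by rewrite E; [move=> /le_trans; apply; exact: cP | lia].
(* Since [lam > 0], the default value 0 of the maximum does not reach it, so some average does. *)
have [j kj lj] : exists2 j : 'I_n.+1, (k < j)%N & lam <= avg k j.
  have /bigmax_geP := lc; case; first by rewrite leNgt lam0.
  by move=> [j ? ?]; exists j.
exists (nat_of_ord j); first by have := ltn_ord j; lia.
by rewrite E.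
Qed.

(** The reflection [k -> n - 1 - k] of the indices reduces this to [right_maximal]. *)
Lemma left_maximal p f mu (n : nat) :
  1 < p -> (forall k, 0 <= f k) -> (forall k, 0 < mu k) ->
  exists c, [/\ forall k, 0 <= c k,
    forall i j, (i <= j < n)%N ->
      \sum_(i <= l < j.+1) f l * mu l <= c j * \sum_(i <= l < j.+1) mu l &
    \sum_(0 <= l < n) c l `^ p * mu l <=
      (p / (p - 1)) `^ p * \sum_(0 <= l < n) f l `^ p * mu l].
Proof.
move=> p1 f0 mu0.
pose rv (F : nat -> R) k := F (n - k.+1)%N.
have sumE (F : nat -> R) i j :
    \sum_(i <= l < j) F l = \sum_(l < j - i) F (l + i)%N.
  by rewrite -{1}[i]add0n big_addn big_mkord.
have rvE (F : nat -> R) i j : (i <= j < n)%N ->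
    \sum_(i <= l < j.+1) F l = \sum_(n - j.+1 <= l < n - i) rv F l.
  move=> ij; rewrite big_nat_rev /= !sumE.
  rewrite (_ : (n - i - (n - j.+1) = j.+1 - i)%N); last by lia.
  by apply: eq_bigr => l _; rewrite /rv; congr F; have := ltn_ord l; lia.
have rvT (F : nat -> R) : \sum_(0 <= l < n) F l = \sum_(0 <= l < n) rv F l.
  by rewrite big_nat_rev.
have [c [c0 c1 c2]] := right_maximal p (rv f) (rv mu) n p1
  (fun k => f0 _) (fun k => mu0 _).
exists (rv c); split => [k|i j ij|]; first exact: c0.
  by rewrite !(rvE _ _ _ ij); apply: c1; lia.
rewrite rvT [X in _ <= _ * X]rvT; apply: le_trans c2.
rewrite le_eqVlt; apply/orP; left; apply/eqP/eq_big_nat => k kn.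
rewrite /rv; congr (c _ `^ _ * _); lia.
Qed.

(** Each one-sided maximal function contributes [(p/(p-1))^p], splitting the [p]-th power of their
    sum costs [2^p], and the last factor 2 counts the two sides. *)
Definition maximal_const p : R := (2 * (p / (p - 1))) `^ p * 2.

Lemma powR_add_le p (a b : R) : 0 < p -> 0 <= a -> 0 <= b ->
  (a + b) `^ p <= 2 `^ p * (a `^ p + b `^ p).
Proof.
move=> p0 a0 b0.
wlog ab : a b a0 b0 / a <= b.
  by move=> H; have [/H|/ltW/H] := leP a b; [|rewrite addrC (addrC (a `^ p))]; exact.
apply: (@le_trans _ _ ((2 * b) `^ p)).
  by rewrite ge0_ler_powR ?nnegrE ?(ltW p0) ?mulr_ge0 ?addr_ge0 //; lra.
rewrite powRM // ler_wpM2l ?powR_ge0 // lerDr powR_ge0 //.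
Qed.

(* On the line every interval around [k] is a left interval and a right one
   at [k], so no covering lemma is needed. *)
Lemma universal_maximal p f mu (n : nat) :
  1 < p -> (forall k, 0 <= f k) -> (forall k, 0 < mu k) ->
  exists c, [/\ forall k, 0 <= c k,
    forall i k j, (i <= k < j)%N -> (j <= n)%N ->
      \sum_(i <= l < j) f l * mu l <= c k * \sum_(i <= l < j) mu l &
    \sum_(0 <= l < n) c l `^ p * mu l <=
      maximal_const p * \sum_(0 <= l < n) f l `^ p * mu l].
Proof.
move=> p1 f0 mu0.
have [a [a0 a1 a2]] := right_maximal p f mu n p1 f0 mu0.
have [b [b0 b1 b2]] := left_maximal p f mu n p1 f0 mu0.
have p10 : 0 < p - 1 by lra.
have p0 : 0 < p by lra.
exists (fun k => a k + b k); split=> [k|i k j /andP[ik kj] jn|].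
- by rewrite addr_ge0.
- have fmu0 l : 0 <= f l * mu l by rewrite mulr_ge0 // ltW.
  have mu0' l : 0 <= mu l by exact: ltW.
  (* The index [k] goes to the left part; the right part, from [k + 1] on, is enlarged to start at
     [k], where the bound by [a k] applies. *)
  rewrite mulrDl (@big_cat_nat _ _ _ k.+1) //=; last by lia.
  rewrite addrC lerD //.
    apply: le_trans (_ : \sum_(k <= l < j) f l * mu l <= _).
      by rewrite [leRHS]big_ltn // lerDr.
    apply: le_trans (a1 _ _ _) _; first by lia.
    by rewrite ler_wpM2l // le_sum_subrange //; lia.
  apply: le_trans (b1 _ _ _) _; first by lia.
  by rewrite ler_wpM2l // le_sum_subrange //; lia.
apply: (@le_trans _ _ (2 `^ p * (\sum_(0 <= l < n) a l `^ p * mu l +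
    \sum_(0 <= l < n) b l `^ p * mu l))).
  rewrite -big_split mulr_sumr /=; apply: ler_sum => l _.
  rewrite -mulrDl mulrA ler_wpM2r ?(ltW (mu0 l)) //.
  exact: powR_add_le.
rewrite /maximal_const powRM ?divr_ge0 ?(ltW p0) ?(ltW p10) // -!mulrA.
rewrite ler_wpM2l ?powR_ge0 //; lra.
Qed.

End UniversalMaximal.

(** * Hölder's inequality, the A_r condition and the strong type inequality on a window *)

Section WeightedInequalities.
Context {R : realType}.
Implicit Types (a p q r x y B : R) (f g u sg mu : nat -> R).

Lemma ler_powRl a x y : 0 <= a -> 0 <= x -> x <= y -> x `^ a <= y `^ a.
Proof.
by move=> a0 x0 xy; rewrite ge0_ler_powR ?nnegrE // (le_trans x0).
Qed.

Lemma powRVK a x : 0 < a -> 0 <= x -> (x `^ a^-1) `^ a = x.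
Proof. by move=> a0 x0; rewrite -powRrM mulVf ?gt_eqF // powRr1. Qed.

Lemma powRKV a x : 0 < a -> 0 <= x -> (x `^ a) `^ a^-1 = x.
Proof. by move=> a0 x0; rewrite -powRrM mulfV ?gt_eqF // powRr1. Qed.

Lemma ler_powRV a x y : 0 < a -> 0 <= x -> x `^ a <= y -> x <= y `^ a^-1.
Proof.
move=> a0 x0 xy; rewrite -[leLHS](powRKV a) //.
by rewrite ler_powRl ?invr_ge0 ?powR_ge0 // ltW.
Qed.

Lemma powRDp a b x : 0 < x -> x `^ (a + b) = x `^ a * x `^ b.
Proof. by move=> x0; rewrite powRD // (gt_eqF x0) implybT. Qed.

Lemma powRDn a b x : a + b != 0 -> x `^ (a + b) = x `^ a * x `^ b.
Proof. by move=> ab; rewrite powRD // (negbTE ab). Qed.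

Lemma powR_inv x a : 0 <= x -> x^-1 `^ a = x `^ (- a).
Proof. by move=> x0; rewrite -powR_inv1 // -powRrM mulN1r. Qed.

Lemma sum_nat_gt0 g (i j : nat) :
  (forall k, 0 < g k) -> (i < j)%N -> 0 < \sum_(i <= l < j) g l.
Proof.
move=> g0 ij; rewrite big_ltn //; apply: ltr_pwDl => //.
by apply: sumr_ge0 => *; exact: ltW.
Qed.

(** Young's inequality [p a^(p-1) g <= (p-1) a^p + g^p], with [a] the mean of [g], is summed against
    [mu]. *)
Lemma jensen_powR p g mu (i j : nat) : 1 < p -> (i < j)%N ->
  (forall k, 0 <= g k) -> (forall k, 0 < mu k) ->
  ((\sum_(i <= l < j) g l * mu l) / \sum_(i <= l < j) mu l) `^ p *
    (\sum_(i <= l < j) mu l) <= \sum_(i <= l < j) g l `^ p * mu l.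
Proof.
move=> p1 ij g0 mu0.
have M0 := sum_nat_gt0 mu i j mu0 ij.
set M := \sum_(i <= l < j) mu l in M0 *.
set a := _ / M.
have a0 : 0 <= a.
  rewrite divr_ge0 ?(ltW M0) // sumr_ge0 // => l _.
  by rewrite mulr_ge0 // ltW.
have aM : a * M = \sum_(i <= l < j) g l * mu l by rewrite divfK // gt_eqF.
have H : p * (a `^ (p - 1) * (a * M)) <=
    (p - 1) * (a `^ p * M) + \sum_(i <= l < j) g l `^ p * mu l.
  rewrite aM /M !mulr_sumr -big_split /=; apply: ler_sum => l _.
  have := powR_young p a (g l) p1 a0 (g0 l).
  by move=> /(ler_wpM2r (ltW (mu0 l))); lra.
have E : a `^ (p - 1) * (a * M) = a `^ p * M.
  by rewrite mulrA [_ * a]mulrC mulr_powRB1 //; lra.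
by move: H; rewrite E; lra.
Qed.

(** Jensen's inequality for [f / sg] with respect to the measure [sg]. *)
Lemma holder_sum p f sg (i j : nat) : 1 < p -> (i < j)%N ->
  (forall k, 0 <= f k) -> (forall k, 0 < sg k) ->
  (\sum_(i <= l < j) f l) `^ p <=
    (\sum_(i <= l < j) f l `^ p * sg l `^ (1 - p)) *
    (\sum_(i <= l < j) sg l) `^ (p - 1).
Proof.
move=> p1 ij f0 sg0.
have S0 := sum_nat_gt0 sg i j sg0 ij.
have := jensen_powR p (fun l => f l / sg l) sg i j p1 ij
  (fun l => divr_ge0 (f0 l) (ltW (sg0 l))) sg0.
under eq_bigr do rewrite divfK ?gt_eqF //.
under [leRHS]eq_bigr => l _.
  rewrite powRM ?invr_ge0 ?(ltW (sg0 l)) // powR_inv ?(ltW (sg0 l)) //.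
  rewrite -mulrA -[X in _ * X](_ : sg l `^ (1 - p) = _); last first.
    by rewrite addrC powRDp // powRr1 ?(ltW (sg0 l)).
  over.
have F0 : 0 <= \sum_(i <= l < j) f l by exact: sumr_ge0.
set S := \sum_(i <= l < j) sg l in S0 *.
rewrite powRM ?invr_ge0 ?(ltW S0) // powR_inv ?(ltW S0) // -mulrA.
rewrite -{2}[S]powRr1 ?(ltW S0) // -powRDp // => H.
rewrite -ler_pdivrMr ?powR_gt0 // -powRN.
by have -> : - (p - 1) = - p + 1 by lra.
Qed.

(** The A_r condition for [u] on the one interval [[i, j)], with [sg] standing for the dual weight
    [u^(-1/(r-1))]. *)
Definition Ar_bound r B u sg (i j : nat) :=
  (\sum_(i <= l < j) u l) / (j - i)%:R *
  ((\sum_(i <= l < j) sg l) / (j - i)%:R) `^ (r - 1) <= B.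

Lemma Ar_boundE r B u sg (i j : nat) : (i < j)%N -> 0 < r ->
   (forall k, 0 < sg k) ->
  Ar_bound r B u sg i j =
  ((\sum_(i <= l < j) u l) * (\sum_(i <= l < j) sg l) `^ (r - 1)
    <= B * (j - i)%:R `^ r).
Proof.
move=> ij r0 sg0.
have S0 := sum_nat_gt0 sg i j sg0 ij.
have L0 : 0 < (j - i)%:R :> R by rewrite ltr0n subn_gt0.
rewrite /Ar_bound -(mulr_powRB1 (ltW L0) r0).
rewrite powRM ?(ltW S0) ?invr_ge0 ?(ltW L0) // powR_inv ?(ltW L0) // powRN.
set L := (j - i)%:R in L0 *.
by rewrite mulrACA -invfM ler_pdivrMr // mulr_gt0 ?powR_gt0.
Qed.

(** Hölder's inequality for the constant 1 on the small interval [J1] gives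
    [|J1|^r <= u(J1) sg(J1)^(r-1)]; then [sg(J1) <= sg(J)] and the A_r bound on the large interval
    [J] conclude. *)
Lemma Ar_doubling r B u sg (i i1 j1 j : nat) : 1 < r ->
  (i <= i1)%N -> (i1 < j1)%N -> (j1 <= j)%N ->
  (forall k, 0 < sg k) -> (forall k, u k = sg k `^ (1 - r)) ->
  Ar_bound r B u sg i j ->
  (j1 - i1)%:R `^ r * \sum_(i <= l < j) u l <=
    B * (j - i)%:R `^ r * \sum_(i1 <= l < j1) u l.
Proof.
move=> r1 ii ij jj sg0 us; rewrite Ar_boundE //; [|lia..|lra] => H.
have u0 k : 0 < u k by rewrite us powR_gt0.
have U0 : 0 <= \sum_(i <= l < j) u l.
  by apply: sumr_ge0 => l _; exact: ltW.
have U10 : 0 <= \sum_(i1 <= l < j1) u l.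
  by apply: sumr_ge0 => l _; exact: ltW.
have := holder_sum r (fun=> 1) sg i1 j1 r1 ij (fun=> ler01) sg0.
rewrite big_const_nat iter_addr addr0.
under eq_bigr do rewrite powR1 mul1r -us.
move=> K; apply: le_trans (ler_wpM2r U0 K) _.
rewrite [leRHS]mulrC -mulrA ler_wpM2l //.
apply: le_trans H; rewrite mulrC ler_wpM2l // ler_powRl //; first by lra.
  by apply: sumr_ge0 => l _; exact: ltW.
by apply: le_sum_subrange => //; [move=> l; exact: ltW | exact: ltnW].
Qed.

(** Here [r / q] is [1 - alpha]. Hölder's inequality leaves [sg(J)^((p-1)/p)], and since
    [(p-1)/p = (r-1)/q] the A_r bound turns it into a multiple of [u(J)^(-1/q)]. *)
Lemma Ar_average p q r B f u sg (i j : nat) : 1 < p -> p < q ->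
  r = q - q / p + 1 -> (i < j)%N -> 0 <= B ->
  (forall k, 0 <= f k) -> (forall k, 0 < u k) -> (forall k, 0 < sg k) ->
  Ar_bound r B u sg i j ->
  (j - i)%:R `^ (- (r / q)) * \sum_(i <= l < j) f l <=
    B `^ q^-1 * (\sum_(i <= l < j) u l) `^ (- q^-1) *
    (\sum_(i <= l < j) f l `^ p * sg l `^ (1 - p)) `^ p^-1.
Proof.
move=> p1 pq rE ij B0 f0 u0 sg0.
have pp : p * p^-1 = 1 by rewrite mulfV //; lra.
have r1 : 1 < r.
  rewrite rE ltrDr subr_gt0 gtr_pMr; last by lra.
  by rewrite invf_lt1; lra.
rewrite Ar_boundE //; last by lra.
have H := holder_sum p f sg i j p1 ij f0 sg0.
have S0 := sum_nat_gt0 sg i j sg0 ij.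
have U0 := sum_nat_gt0 u i j u0 ij.
have L0 : 0 < (j - i)%:R :> R by rewrite ltr0n subn_gt0.
have F0 : 0 <= \sum_(i <= l < j) f l by exact: sumr_ge0.
move: H S0 U0 L0 F0.
set F := \sum_(i <= l < j) f l.
set G := \sum_(i <= l < j) f l `^ p * _.
set S := \sum_(i <= l < j) sg l.
set U := \sum_(i <= l < j) u l.
set L : R := (j - i)%:R.
move=> H S0 U0 L0 F0 A.
have p0 : 0 < p by lra.
have q0 : 0 < q by lra.
have G0 : 0 <= G.
  by apply: sumr_ge0 => l _; rewrite mulr_ge0 ?powR_ge0.
have FS : F <= G `^ p^-1 * S `^ ((r - 1) / q).
  have -> : (r - 1) / q = (p - 1) * p^-1.
    rewrite rE addrK mulrBl mulfV ?gt_eqF // mulrBl pp mul1r.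
    by rewrite mulrAC mulfV ?gt_eqF // mul1r.
  rewrite powRrM -powRM ?powR_ge0 //.
  exact: ler_powRV.
have SB : S `^ ((r - 1) / q) <= B `^ q^-1 * U `^ (- q^-1) * L `^ (r / q).
  rewrite powRrM [L `^ _]powRrM -[U `^ _]powR_inv ?(ltW U0) //.
  rewrite -!powRM ?mulr_ge0 ?powR_ge0 ?invr_ge0 ?(ltW U0) //.
  rewrite ler_powRl ?powR_ge0 ?invr_ge0 ?(ltW q0) //.
  by rewrite mulrAC ler_pdivlMr // mulrC.
rewrite powRN mulrC ler_pdivrMr ?powR_gt0 //.
apply: le_trans FS _.
apply: le_trans (ler_wpM2l (powR_ge0 _ _) SB) _.
by rewrite mulrC -!mulrA; do 2 rewrite ler_wpM2l ?powR_ge0 //; rewrite mulrC.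
Qed.

(** Lerner's argument on the window [[0, n)]: two universal maximal functions, [a] for [sg] and then
    [b] for [u], are composed, so the weights enter the constant only through a power of [B]. *)
Lemma local_strong_type p q r B f u sg (n : nat) : 1 < p -> p < q ->
  r = q - q / p + 1 -> 0 <= B ->
  (forall k, 0 <= f k) -> (forall k, 0 < sg k) ->
  (forall k, u k = sg k `^ (1 - r)) ->
  (forall i j, (i < j <= n)%N -> Ar_bound r B u sg i j) ->
  exists c, [/\ forall k, 0 <= c k,
    forall i k j, (i <= k < j)%N -> (j <= n)%N ->
      (j - i)%:R `^ (- (r / q)) * \sum_(i <= l < j) f l <= c k &
    \sum_(0 <= l < n) c l `^ q * u l <=
      B `^ (r / (r - 1)) * maximal_const (r / (r - 1)) * maximal_const p *
      (\sum_(0 <= l < n) f l `^ p * sg l `^ (1 - p)) `^ (q / p)].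
Proof.
move=> p1 pq rE B0 f0 sg0 us HA.
have p0 : 0 < p by lra.
have q0 : 0 < q by lra.
have r1 : 1 < r.
  by rewrite rE ltrDr subr_gt0 gtr_pMr // invf_lt1.
have r0 : 0 < r by lra.
have u0 k : 0 < u k by rewrite us powR_gt0.
set r' := r / (r - 1).
have r'0 : 0 < r' by rewrite divr_gt0 //; lra.
have r'V : (r - 1) * r' = r by rewrite mulrCA mulfV ?mulr1 //; lra.
have r'1 : 1 < r' by rewrite /r' ltr_pdivlMr; lra.
pose g k := f k / sg k.
have g0 k : 0 <= g k by rewrite divr_ge0 // ltW.
have [a [a0 a1 a2]] := universal_maximal p g sg n p1 g0 sg0.
(* By this choice [h u = a^(p/r')], and since [(1 - r)(1 - r') = 1] also [h^r' u = a^p sg], which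
   links the bound for [b] to the one for [a]. *)
pose h k := a k `^ (p / r') / u k.
have h0 k : 0 <= h k by rewrite divr_ge0 ?powR_ge0 // ltW.
have [b [b0 b1 b2]] := universal_maximal r' h u n r'1 h0 u0.
have gsg k : g k * sg k = f k by rewrite /g divfK // gt_eqF.
have gpsg k : g k `^ p * sg k = f k `^ p * sg k `^ (1 - p).
  rewrite /g powRM ?invr_ge0 ?(ltW (sg0 k)) // powR_inv ?(ltW (sg0 k)) //.
  by rewrite -mulrA addrC powRDp // powRr1 ?(ltW (sg0 k)).
have hu k : h k * u k = a k `^ (p / r') by rewrite /h divfK // gt_eqF.
have hru k : h k `^ r' * u k = a k `^ p * sg k.
  rewrite /h powRM ?invr_ge0 ?powR_ge0 ?(ltW (u0 k)) // -powRrM.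
  rewrite divfK ?gt_eqF // powR_inv ?(ltW (u0 k)) // -mulrA; congr (_ * _).
  rewrite -{2}[u k]powRr1 ?(ltW (u0 k)) // -powRDp // us -powRrM.
  have -> : (1 - r) * (- r' + 1) = 1 by lra.
  by rewrite powRr1 // ltW.
rewrite (eq_bigr _ (fun l _ => gpsg l)) in a2.
set G := \sum_(0 <= l < n) f l `^ p * _ in a2 *.
have G0 : 0 <= G by apply: sumr_ge0 => l _; rewrite mulr_ge0 ?powR_ge0.
pose e := (q - p) / p.
have e0 : 0 < e by rewrite divr_gt0 //; lra.
have epq : e * p = q - p by rewrite divfK // gt_eqF.
pose K := B `^ r' * G `^ e.
have K0 : 0 <= K by rewrite mulr_ge0 ?powR_ge0.
(* The witness satisfies [c^q = K b^r'], the bound that the averaging below yields for the [q]-th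
   power. *)
exists (fun k => (K * b k `^ r') `^ q^-1); split => [k|i k j ikj jn|].
- exact: powR_ge0.
- have ij : (i < j)%N by case/andP: ikj => /leq_ltn_trans; apply.
  have S0 := sum_nat_gt0 sg i j sg0 ij.
  have U0 := sum_nat_gt0 u i j u0 ij.
  have L0 : 0 < (j - i)%:R :> R by rewrite ltr0n subn_gt0.
  have F0 : 0 <= \sum_(i <= l < j) f l by exact: sumr_ge0.
  have FG := holder_sum p f sg i j p1 ij f0 sg0.
  have {}FG : (\sum_(i <= l < j) f l) `^ p <=
      G * (\sum_(i <= l < j) sg l) `^ (p - 1).
    apply: le_trans FG _; rewrite ler_wpM2r ?powR_ge0 //.
    by apply: le_sum_subrange => //; [move=> l; rewrite mulr_ge0 ?powR_ge0 | exact: ltnW].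
  have Fa (y : nat) : (i <= y < j)%N ->
      \sum_(i <= l < j) f l <= a y * \sum_(i <= l < j) sg l.
    by move=> /a1/(_ jn); under eq_bigr do rewrite gsg.
  have := b1 i k j ikj jn; rewrite (eq_bigr _ (fun l _ => hu l)) => hM.
  have HB : Ar_bound r B u sg i j by apply: HA; rewrite ij.
  move: HB; rewrite /Ar_bound; move: S0 U0 L0 F0 FG Fa hM.
  set F := \sum_(i <= l < j) f l.
  set S := \sum_(i <= l < j) sg l.
  set U := \sum_(i <= l < j) u l.
  set L : R := (j - i)%:R.
  move=> S0 U0 L0 F0 FG Fa hM HB.
  pose T := L `^ (- (r / q)) * F.
  have T0 : 0 <= T by rewrite mulr_ge0 ?powR_ge0.
  apply: ler_powRV => //; rewrite -/T.
  (* Since [q = p + p e], the factor [F^p] is bounded through [a y] and the factor [F^(p e)] by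
     Hölder's inequality; the resulting powers of [S] combine to [S^r]. *)
  have FqE (y : nat) : (i <= y < j)%N -> F `^ q <= G `^ e * a y `^ p * S `^ r.
    move=> iyj.
    have -> : q = p + p * e by rewrite mulrC epq; lra.
    rewrite powRDn; last by rewrite mulrC epq; lra.
    rewrite powRrM.
    apply: (@le_trans _ _ ((a y * S) `^ p * (G * S `^ (p - 1)) `^ e)).
      by rewrite ler_pM ?powR_ge0 // ler_powRl ?powR_ge0 ?Fa // ltW.
    rewrite !powRM ?powR_ge0 ?(ltW S0) // -powRrM mulrACA -powRDp //.
    rewrite [a y `^ p * _]mulrC.
    have -> : p + (p - 1) * e = r; last by [].
    by rewrite mulrBl mul1r [p * e]mulrC epq rE /e mulrBl mulfV ?gt_eqF //; lra.
  have TqE : T `^ q = L `^ (- r) * F `^ q.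
    by rewrite powRM ?powR_ge0 // -powRrM mulNr divfK // gt_eqF.
  have HB' : (U / L) `^ r' * (S / L) `^ r <= B `^ r'.
    have UL0 : 0 <= U / L by rewrite divr_ge0 // ltW.
    rewrite -[in (S / L) `^ _]r'V [(S / L) `^ _]powRrM -powRM ?powR_ge0 //.
    exact: (ler_powRl _ _ _ (ltW r'0) (mulr_ge0 UL0 (powR_ge0 _ _)) HB).
  have TU (y : nat) : (i <= y < j)%N ->
      T `^ q * U `^ r' <= K * (L * a y `^ (p / r')) `^ r'.
    move=> /FqE Fy.
    rewrite TqE powRM ?powR_ge0 ?(ltW L0) // -powRrM divfK ?gt_eqF // /K.
    have := ler_wpM2l (mulr_ge0 (powR_ge0 G e)
      (mulr_ge0 (powR_ge0 (a y) p) (powR_ge0 L r'))) HB'.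
    rewrite !powRM ?invr_ge0 ?(ltW S0) ?(ltW U0) ?(ltW L0) //.
    rewrite !powR_inv ?(ltW L0) // => H.
    have LL : L `^ r' * L `^ (- r') = 1 by rewrite -powRDp // subrr powRr0.
    apply: (@le_trans _ _ (L `^ (- r) * (G `^ e * a y `^ p * S `^ r) * U `^ r')).
      by rewrite ler_wpM2r ?powR_ge0 // ler_wpM2l ?powR_ge0.
    apply: le_trans (_ : _ <= G `^ e * (a y `^ p * L `^ r') * B `^ r') _; last by lra.
    apply: le_trans H; rewrite le_eqVlt; apply/orP; left; apply/eqP.
    have -> : G `^ e * (a y `^ p * L `^ r') *
       (U `^ r' * L `^ (- r') * (S `^ r * L `^ (- r))) =
       G `^ e * a y `^ p * U `^ r' * S `^ r * L `^ (- r) * (L `^ r' * L `^ (- r')).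
      by lra.
    by rewrite LL; lra.
  (* The left side of [TU] does not depend on [y]: its power [1/r'] is summed over the interval, and
     [hM] bounds the sum of [a^(p/r')] by [b k * U]. *)
  have : T `^ (q / r') * U <= K `^ r'^-1 * (b k * U).
    apply: le_trans (ler_wpM2l (powR_ge0 _ _) hM).
    rewrite -(ler_pM2r L0).
    have E (x : R) : x * L = \sum_(i <= l < j) x.
      by rewrite big_const_nat iter_addr addr0 mulr_natr.
    rewrite E [leRHS]mulrAC [leRHS]mulr_sumr.
    rewrite [leLHS]big_nat [leRHS]big_nat; apply: ler_sum => y iyj; rewrite -mulrA.
    have rV0 : 0 <= r'^-1 by rewrite invr_ge0 ltW.
    have La0 : 0 <= L * a y `^ (p / r') by rewrite mulr_ge0 ?powR_ge0 // ltW.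
    have TU0 : 0 <= T `^ q * U `^ r' by rewrite mulr_ge0 ?powR_ge0.
    have := ler_powRl _ _ _ rV0 TU0 (TU y iyj).
    rewrite (powRM _ (powR_ge0 T q) (powR_ge0 U r')) (powRM _ K0 (powR_ge0 _ r')).
    by rewrite (powRKV _ _ r'0 (ltW U0)) (powRKV _ _ r'0 La0) -powRrM.
  rewrite mulrA ler_pM2r // => /(ler_powRl _ _ _ (ltW r'0) (powR_ge0 _ _)).
  rewrite powRM ?powR_ge0 // powRVK // -powRrM divfK ?gt_eqF //.
(* The bound for [b], the identity [hru] and the bound for [a] are chained; [G^e] from [K] and the
   remaining [G] make [G^(q/p)]. *)
under eq_bigr => l _.
  rewrite powRVK ?mulr_ge0 ?powR_ge0 // -mulrA; over.
rewrite -mulr_sumr /K.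
rewrite (eq_bigr _ (fun l _ => hru l)) in b2.
have qpE : q / p = e + 1 by rewrite /e mulrBl mulfV ?gt_eqF // subrK.
rewrite qpE powRDn ?powRr1 //; last by rewrite gt_eqF // addr_gt0.
have M0 x : 0 <= maximal_const x :> R by rewrite mulr_ge0 ?powR_ge0.
have := le_trans b2 (ler_wpM2l (M0 r') a2).
by move=> /(ler_wpM2l K0); rewrite /K; lra.
Qed.
End WeightedInequalities.

(** * Passage from intervals of integers to ranges of natural indices *)

Section IntegerIntervals.
Context {R : realType}.
Implicit Types (a b c d k m : int) (N i j n : nat) (F w x : int -> R).

(** Indices are counted from a base point [a]; [d + 1] appears because [[c, d]] contains its right
    end while the range [[i, j)] does not. *)
Lemma sum_int_itv F a c d i j : c = a + i%:Z -> d + 1 = a + j%:Z ->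
  \sum_(k \in `[c, d]) F k = \sum_(i <= l < j) F (a + l%:Z).
Proof.
move=> ac ad; rewrite [RHS]fsbig_seq ?iota_uniq //.
rewrite (@reindex_fsbig _ _ _ _ _ (fun l : nat => a + l%:Z)
  [set` index_iota i j]) //; split.
- by move=> l /=; rewrite mem_index_iota in_itv /=; lia.
- by move=> l l' _ _ /= /addrI [].
- move=> k /=; rewrite in_itv /= => ck; exists `|k - a|%N => /=.
    by rewrite mem_index_iota; lia.
  by lia.
Qed.

Lemma sum_dball F a m N i j : m - N%:Z = a + i%:Z -> m + N%:Z + 1 = a + j%:Z ->
  \sum_(k \in dball m N) F k = \sum_(i <= l < j) F (a + l%:Z).
Proof. by move=> ai aj; rewrite dballE; apply: sum_int_itv. Qed.

Lemma cardR_sum (A : set int) : finite_set A -> cardR R A = \sum_(k \in A) (1 : R).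
Proof.
by move=> fA; rewrite fsbig_finite // /cardR card_fset_sum1 natr_sum.
Qed.

Lemma cardR_int_itv a c d i j : c = a + i%:Z -> d + 1 = a + j%:Z ->
  cardR R `[c, d] = (j - i)%:R.
Proof.
move=> ac ad; rewrite cardR_sum; last exact: finite_int_itv.
rewrite (sum_int_itv (fun=> 1 : R) _ _ _ _ _ ac ad).
by rewrite big_const_nat iter_addr addr0.
Qed.

Lemma cardR_dball m N : cardR R (dball m N) = (2 * N + 1)%:R.
Proof.
rewrite dballE (cardR_int_itv (m - N%:Z) _ _ 0 (2 * N + 1)) ?subn0 //; lia.
Qed.

(** Since [q / p' = q - q / p], this is the [q]-th power of the A(p,q) condition; [B] is the [q]-th
    power of the supremum, hence the same for every base point [a]. *)
Lemma Apq_Ar_bound (p q : R) w : 1 < p -> 0 < q -> is_weight w -> Apq p q w ->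
  exists2 B, 0 <= B & forall a i j, (i < j)%N ->
    Ar_bound (q - q / p + 1) B (fun l => w (a + l%:Z) `^ q)
      (fun l => w (a + l%:Z) `^ (- conj_exp p)) i j.
Proof.
move=> p1 q0 w0; rewrite /Apq; set E := ereal_sup _ => Ely.
have p'0 : 0 < conj_exp p by rewrite /conj_exp divr_gt0; lra.
have EB a i j : (i < j)%N ->
    ((((j - i)%:R^-1 * \sum_(i <= l < j) w (a + l%:Z) `^ q) `^ q^-1 *
    ((j - i)%:R^-1 * \sum_(i <= l < j) w (a + l%:Z) `^ (- conj_exp p)) `^
      (conj_exp p)^-1)%:E <= E)%E.
  move=> ij; apply: ereal_sup_ubound; exists `[a + i%:Z, a + j%:Z - 1]%classic.
    by exists (a + i%:Z), (a + j%:Z - 1); split => //; lia.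
  rewrite (cardR_int_itv a _ _ i j) ?subrK //.
  by rewrite /wsum !(sum_int_itv _ a _ _ i j) ?subrK.
exists (fine E `^ q); first exact: powR_ge0.
move=> a i j ij.
have E0 := EB a i j ij.
have Efin : E \is a fin_num.
  by rewrite fin_real // Ely andbT (lt_le_trans _ E0) // ltNyr.
rewrite -(fineK Efin) lee_fin in E0.
move: E0; rewrite /Ar_bound ![_^-1 * \sum_(i <= l < j) _]mulrC.
have L0 : 0 <= (j - i)%:R^-1 :> R by rewrite invr_ge0.
have : 0 <= (\sum_(i <= l < j) w (a + l%:Z) `^ q) / (j - i)%:R.
  by rewrite mulr_ge0 // sumr_ge0 // => l _; exact: powR_ge0.
have : 0 <= (\sum_(i <= l < j) w (a + l%:Z) `^ (- conj_exp p)) / (j - i)%:R.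
  by rewrite mulr_ge0 // sumr_ge0 // => l _; exact: powR_ge0.
set U := (\sum_(i <= l < j) w (a + l%:Z) `^ q) / _.
set S := _ / (j - i)%:R.
move=> S0 U0 /(ler_powRl _ _ _ (ltW q0)) H.
have -> : q - q / p + 1 - 1 = (conj_exp p)^-1 * q.
  rewrite addrK /conj_exp invf_div mulrBl divff; last by lra.
  lra.
rewrite powRrM -{1}(powRVK q U q0 U0) -powRM ?powR_ge0 // H //.
by rewrite mulr_ge0 ?powR_ge0.
Qed.

End IntegerIntervals.

(** * Local bound for the fractional maximal function on a fixed ball *)

Section Morrey.
Context {R : realType}.
Implicit Types (alpha p q s r B X : R) (w x : int -> R).

Ltac index_lia :=
  repeat match goal with H : context [R] |- _ => clear H end; lia.

(* Averages over balls of radius at most [2N] see only [S_{m,3N}] and are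
   controlled by the strong type inequality; the larger ones are bounded by a
   constant, by Hölder's inequality on the concentric ball [S_{m,N'+N}]. *)
Lemma frac_maximal_dball alpha p q r B w :
  0 < alpha -> alpha < 1 -> 1 < p -> p < q -> q^-1 = p^-1 - alpha ->
  alpha < q^-1 -> r = q - q / p + 1 -> is_weight w -> 0 <= B ->
  (forall (a : int) (i j : nat), (i < j)%N ->
    Ar_bound r B (fun l => w (a + l%:Z) `^ q)
      (fun l => w (a + l%:Z) `^ (- conj_exp p)) i j) ->
  exists2 C : R, 0 <= C & forall x X (m : int) (N : nat), 0 <= X ->
    (forall m' N', (\sum_(k \in dball m' N') `|x k| `^ p * wpow w p k) `^ p^-1
       <= X * wsum (wpow w q) (dball m' N') `^ alpha) ->
    exists c : int -> R, [/\ forall k, 0 <= c k,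
      forall k N', dball m N k ->
        (cardR R (dball k N') `^ (1 - alpha))^-1 *
          \sum_(l \in dball k N') `|x l| <= c k &
      \sum_(k \in dball m N) c k `^ q * wpow w q k <=
        C * X `^ q * wsum (wpow w q) (dball m N) `^ (alpha * q)].
Proof.
move=> alpha0 alpha1 p1 pq qE alphaq rE w0 B0 HB.
have alpha1' : 0 <= 1 - alpha by lra.
have alphaq' : 0 <= q^-1 - alpha by lra.
have p0 : 0 < p by lra.
have q0 : 0 < q by lra.
have qp : q / p = 1 + alpha * q.
  have -> : p^-1 = q^-1 + alpha by lra.
  by rewrite mulrDr mulfV ?gt_eqF // [q * _]mulrC.
have rq : r / q = 1 - alpha.
  rewrite rE qp; have -> : q - (1 + alpha * q) + 1 = (1 - alpha) * q by lra.
  by rewrite mulfK ?gt_eqF.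
have r1 : 1 < r by rewrite rE ltrDr subr_gt0 gtr_pMr // invf_lt1.
set p' := conj_exp p.
have pp' : p' * (p - 1) = p by rewrite /p' /conj_exp divfK //; lra.
have qp' : p' * (r - 1) = q.
  rewrite rE addrK -[X in _ = X]mul1r; have := pp'.
  have -> : q - q / p = q / p * (p - 1) by rewrite mulrBr divfK ?gt_eqF // mulr1.
  by rewrite mulrCA => ->; rewrite divfK ?gt_eqF // mul1r.
have us a l : w (a + l%:Z) `^ q = (w (a + l%:Z) `^ - p') `^ (1 - r).
  by rewrite -powRrM; congr (_ `^ _); lra.
have ps a l : (w (a + l%:Z) `^ - p') `^ (1 - p) = w (a + l%:Z) `^ p.
  by rewrite -powRrM; congr (_ `^ _); lra.
have M0 y : 0 <= maximal_const y :> R by rewrite mulr_ge0 ?powR_ge0.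
have [K K0 KE] : exists2 K, 0 <= K &
    K = B `^ (r / (r - 1)) * maximal_const (r / (r - 1)) * maximal_const p.
  by eexists; last reflexivity; rewrite !mulr_ge0 ?powR_ge0.
(* The outer [2^q] separates near and far averages; the near part carries the strong type constant
   [K] and the doubling factor [B 3^r], and [2^q B] comes from [far^q]. *)
exists (2 `^ q * (K * (B * 3 `^ r) `^ (alpha * q) + 2 `^ q * B)).
  by rewrite mulr_ge0 ?addr_ge0 ?mulr_ge0 ?powR_ge0.
move=> x X m N X0 HX.
have f0 a (l : nat) : 0 <= `|x (a + l%:Z)| by exact: normr_ge0.
have sg0 a (l : nat) : 0 < w (a + l%:Z) `^ - p' by rewrite powR_gt0.
have u0 a (l : nat) : 0 < w (a + l%:Z) `^ q by rewrite powR_gt0.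
have ball (F : int -> R) m' N' : \sum_(k \in dball m' N') F k =
    \sum_(0 <= l < 2 * N' + 1) F (m' - N'%:Z + l%:Z).
  by apply: sum_dball; index_lia.
have HXa m' N' : (\sum_(0 <= l < 2 * N' + 1) `|x (m' - N'%:Z + l%:Z)| `^ p *
     (w (m' - N'%:Z + l%:Z) `^ - p') `^ (1 - p)) `^ p^-1 <=
   X * (\sum_(0 <= l < 2 * N' + 1) w (m' - N'%:Z + l%:Z) `^ q) `^ alpha.
  have := HX m' N'; rewrite /wsum !ball /wpow.
  by rewrite (eq_bigr _ (fun l _ => congr1 _ (esym (ps (m' - N'%:Z) l)))).
set U := wsum (wpow w q) (dball m N).
have UE : U = \sum_(0 <= l < 2 * N + 1) w (m - N%:Z + l%:Z) `^ q.
  by rewrite /U /wsum ball.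
have U0 : 0 < U by rewrite UE; apply: sum_nat_gt0 => //; index_lia.
(* In the window of [6N + 1] indices counted from the left end of [S_{m,3N}], the ball [S_{m,N}]
   occupies the indices [2N] to [4N]. *)
pose a0 := m - (3 * N)%:Z.
have U3 : U = \sum_(2 * N <= l < 4 * N + 1) w (a0 + l%:Z) `^ q.
  by rewrite /U /wsum; apply: sum_dball; rewrite /a0; index_lia.
have [c [c0 c1 c2]] := local_strong_type p q r B (fun l => `|x (a0 + l%:Z)|)
  (fun l => w (a0 + l%:Z) `^ q) (fun l => w (a0 + l%:Z) `^ - p') (6 * N + 1)
  p1 pq rE B0 (f0 a0) (sg0 a0) (us a0)
  (fun i j ij => HB a0 i j (proj1 (andP ij))).
pose far := 2 * B `^ q^-1 * X * U `^ (alpha - q^-1).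
have far0 : 0 <= far by rewrite !mulr_ge0 ?powR_ge0.
exists (fun k => c `|k - a0|%N + far); split => [k|k N' kS|].
- by rewrite addr_ge0.
- move: kS; rewrite /dball /= => kS.
  have [N'N|NN'] := leqP N' (2 * N).
    apply: (@le_trans _ _ (c `|k - a0|%N)); last by rewrite lerDl.
    (* For [k] in [S_{m,N}] the distance to [a0] is at least [2N >= N'], so the natural subtraction
       is not truncated. *)
    pose i := (`|k - a0| - N')%N; pose j := (`|k - a0| + N' + 1)%N.
    rewrite cardR_dball (sum_dball _ a0 _ _ i j); [|rewrite /a0 /i /j; index_lia..].
    rewrite -powRN -rq.
    have -> : (2 * N' + 1 = j - i)%N by rewrite /i /j /a0; index_lia.
    by apply: c1; rewrite /i /j /a0; index_lia.
  apply: (@le_trans _ _ far); last by rewrite lerDr.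
  pose b := m - (N' + N)%:Z; pose n := (2 * (N' + N) + 1)%N.
  pose i := (`|k - b| - N')%N; pose j := (`|k - b| + N' + 1)%N.
  rewrite cardR_dball (sum_dball _ b _ _ i j); [|rewrite /b /i /j; index_lia..].
  have n0 : (0 < n)%N by rewrite /n; index_lia.
  have := Ar_average p q r B (fun l => `|x (b + l%:Z)|) (fun l => w (b + l%:Z) `^ q)
    (fun l => w (b + l%:Z) `^ - p') 0 n p1 pq rE n0 B0 (f0 b) (u0 b) (sg0 b)
    (HB b _ _ n0).
  have := HXa m (N' + N)%N; rewrite -/b -/n subn0 rq.
  set Un := \sum_(0 <= l < n) w (b + l%:Z) `^ q => HXn H.
  have UUn : U <= Un.
    rewrite /U /wsum (sum_dball _ b _ _ N' (N' + 2 * N + 1)); [|rewrite /b; index_lia..].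
    by apply: le_sum_subrange => [l|||]; [exact: powR_ge0|rewrite /n; index_lia..].
  have Un0 : 0 < Un by exact: lt_le_trans UUn.
  have F_le : \sum_(i <= l < j) `|x (b + l%:Z)| <= \sum_(0 <= l < n) `|x (b + l%:Z)|.
    by apply: le_sum_subrange => [l|||]; rewrite // /i /j /n /b; index_lia.
  (* The enclosing ball has [n = 2(N' + N) + 1 <= 2(2N' + 1)] points, and [2^(1-alpha) <= 2]. *)
  have card_le : ((2 * N' + 1)%:R `^ (1 - alpha))^-1 <= 2 * n%:R `^ - (1 - alpha) :> R.
    have L0 : 0 < (2 * N' + 1)%:R :> R by rewrite ltr0n; index_lia.
    have n0R : 0 < n%:R :> R by rewrite ltr0n.
    rewrite powRN ler_pdivlMr ?powR_gt0 // mulrC ler_pdivrMr ?powR_gt0 //.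
    apply: (@le_trans _ _ ((2 * (2 * N' + 1)%:R) `^ (1 - alpha))).
      apply: ler_powRl; [exact: alpha1' | exact: ltW |].
      by rewrite -natrM ler_nat /n; index_lia.
    rewrite powRM ?(ltW L0) // ler_wpM2r ?powR_ge0 //.
    by rewrite ler1_powR ?ler1n // gerBl ltW.
  apply: le_trans (ler_pM _ (sumr_ge0 _ (fun l _ => f0 b l)) card_le F_le) _.
    by rewrite invr_ge0 powR_ge0.
  rewrite /far -!mulrA ler_pM2l //.
  apply: le_trans H _; rewrite -mulrA ler_wpM2l ?powR_ge0 //.
  apply: le_trans (ler_wpM2l (powR_ge0 _ _) HXn) _.
  rewrite mulrCA ler_wpM2l // -powRDp //.
  (* As [alpha < 1/q], the exponent is negative, so [U <= Un] allows [Un] to be replaced by [U]. *)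
  have -> : - q^-1 + alpha = - (q^-1 - alpha) by clear; lra.
  have -> : alpha - q^-1 = - (q^-1 - alpha) by clear; lra.
  by rewrite !powRN lef_pV2 ?posrE ?powR_gt0 // ler_powRl ?(ltW U0).
pose d l := c l `^ q * w (a0 + l%:Z) `^ q.
have d0 l : 0 <= d l by rewrite mulr_ge0 ?powR_ge0.
rewrite (sum_dball _ a0 _ _ (2 * N) (4 * N + 1)); [|rewrite /a0; index_lia..].
apply: (@le_trans _ _ (2 `^ q * (\sum_(2 * N <= l < 4 * N + 1) d l +
    far `^ q * U))).
  rewrite U3 mulr_sumr -big_split mulr_sumr /=; apply: ler_sum => l _.
  have -> : `|(a0 + l%:Z - a0)%R|%N = l by index_lia.
  rewrite /d /wpow -mulrDl mulrA ler_wpM2r ?powR_ge0 //.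
  exact: powR_add_le.
rewrite -!mulrA ler_wpM2l ?powR_ge0 // mulrDl lerD //.
  apply: (@le_trans _ _ (\sum_(0 <= l < 6 * N + 1) d l)).
    by apply: le_sum_subrange => //; index_lia.
  apply: le_trans c2 _; rewrite -KE -[leRHS]mulrA ler_wpM2l //.
  have := HXa m (3 * N)%N; rewrite -/a0.
  have -> : (2 * (3 * N) + 1 = 6 * N + 1)%N by index_lia.
  set W := \sum_(0 <= l < _) w (a0 + l%:Z) `^ q.
  set G := (X in X `^ p^-1 <= _) => HG.
  have W0 : 0 <= W by apply: sumr_ge0 => l _; exact: powR_ge0.
  have G0 : 0 <= G by apply: sumr_ge0 => l _; rewrite mulr_ge0 ?powR_ge0.
  (* Doubling from [S_{m,N}] to [S_{m,3N}]: [6N + 1 <= 3(2N + 1)] gives the factor [3^r]. *)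
  have W3 : W <= B * 3 `^ r * U.
    have ii : (2 * N < 4 * N + 1)%N by index_lia.
    have jj : (4 * N + 1 <= 6 * N + 1)%N by index_lia.
    have n0 : (0 < 6 * N + 1)%N by index_lia.
    have := Ar_doubling r B _ _ 0 (2 * N) (4 * N + 1) (6 * N + 1) r1 (leq0n _)
      ii jj (sg0 a0) (us a0) (HB a0 _ _ n0).
    rewrite -/W -U3 subn0.
    have L0 : 0 < (4 * N + 1 - 2 * N)%:R :> R by rewrite ltr0n; index_lia.
    move=> H; rewrite -(@ler_pM2l _ ((4 * N + 1 - 2 * N)%:R `^ r)) ?powR_gt0 //.
    apply: le_trans H _.
    have -> : (4 * N + 1 - 2 * N)%:R `^ r * (B * 3 `^ r * U) =
      B * (3 `^ r * (4 * N + 1 - 2 * N)%:R `^ r) * U by clear; lra.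
    rewrite ler_wpM2r ?(ltW U0) // ler_wpM2l // -powRM ?(ltW L0) //.
    apply: ler_powRl; [exact: ltW (lt_trans ltr01 r1) | exact: ler0n |].
    by rewrite -natrM ler_nat; index_lia.
  rewrite [q / p]mulrC [leLHS]powRrM.
  apply: le_trans (ler_powRl _ _ _ (ltW q0) (powR_ge0 _ _) HG) _.
  rewrite powRM ?powR_ge0 // mulrCA ler_wpM2l ?powR_ge0 // -powRrM.
  rewrite -powRM ?mulr_ge0 ?powR_ge0 ?(ltW U0) //.
  by rewrite ler_powRl // mulr_ge0 // ltW.
rewrite le_eqVlt; apply/orP; left; apply/eqP.
rewrite /far !powRM ?mulr_ge0 ?powR_ge0 // powRVK // -powRrM.
have -> : U `^ (alpha * q) = U `^ ((alpha - q^-1) * q) * U; last by clear; lra.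
rewrite mulrBl mulVf ?gt_eqF // -{3}[U]powRr1 ?(ltW U0) // -powRDp //.
by rewrite subrK.
Qed.

End Morrey.

(** * Extended-real Morrey norms and the final estimate *)

Lemma lee_poweRl (R : realType) (r : R) (x y : \bar R) :
  0 <= r -> (0 <= x)%E -> (x <= y)%E -> (poweR x r <= poweR y r)%E.
Proof.
move=> r0 x0 xy; apply: gt0_ler_poweR => //; rewrite in_itv /= leey andbT //.
exact: le_trans xy.
Qed.

Lemma le_morrey_norm (R : realType) (p q : R) (u v x : int -> R) m N :
  ((wsum v (dball m N) `^ (q^-1 - p^-1) *
    (\sum_(k \in dball m N) `|x k| `^ p * u k) `^ p^-1)%:E
   <= morrey_norm p q u v (EFin \o x))%E.
Proof.
apply: ereal_sup_ubound; exists (m, N) => //=.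
have -> : (\sum_(k \in dball m N) (poweR `|(x k)%:E| p * (u k)%:E))%E =
    (\sum_(k \in dball m N) `|x k| `^ p * u k)%:E.
  by rewrite -fsumEFin; last exact: finite_dball.
by rewrite poweR_EFin -EFinM.
Qed.

Lemma morrey_norm_ge0 (R : realType) (p q : R) (u v : int -> R) x :
  (0 <= morrey_norm p q u v x)%E.
Proof.
apply: le_trans (ereal_sup_ubound _); last by exists (0, 0%N).
by rewrite mule_ge0 ?poweR_ge0 // lee_fin powR_ge0.
Qed.

Theorem theorem4p10 (R : realType) (alpha p q s : R) (w : int -> R)
    (halpha0 : 0 < alpha) (halpha1 : alpha < 1)
    (hp1 : 1 < p) (hpalpha : p < 1 / alpha)
    (hq : 1 / q = 1 / p - alpha) (hq2p : q < 2 * p)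
    (hs : s = q * p / (2 * p - q))
    (hw : is_weight w) (hwA : Apq p q w) :
  exists C : R, 0 < C /\
    forall x : int -> R,
      morrey p q (wpow w p) (wpow w q) x ->
      (morrey_norm q s (wpow w q) (wpow w q) (frac_maximal alpha x)
       <= C%:E * morrey_norm p q (wpow w p) (wpow w q) (EFin \o x))%E.
Proof.
have p0 : 0 < p by lra.
have qE : q^-1 = p^-1 - alpha by move: hq; rewrite !div1r.
have alphap : alpha < p^-1.
  by rewrite -[alpha]invrK ltf_pV2 ?posrE ?invr_gt0 // -div1r.
have q0 : 0 < q by rewrite -invr_gt0; lra.
have pq : p < q by rewrite -ltf_pV2 ?posrE //; lra.
(* As [alpha = 1/p - 1/q], this is the hypothesis [q < 2p]; it makes the bound for large balls
   decrease in the weight. *)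
have alphaq : alpha < q^-1.
  have : (2 * p)^-1 < q^-1 by rewrite ltf_pV2 ?posrE //; lra.
  by rewrite invfM; lra.
(* From [1/s = 2/q - 1/p]: both Morrey norms carry the same power [-alpha] of the weight of the
   ball. *)
have sE : s^-1 - q^-1 = - alpha.
  have -> : s^-1 = 2 * q^-1 * (p / p) - p^-1 * (q / q).
    by rewrite hs invf_div invfM; clear; lra.
  by rewrite !divff ?gt_eqF //; lra.
have pqE : q^-1 - p^-1 = - alpha by lra.
have [B B0 HB] := Apq_Ar_bound p q w hp1 q0 hw hwA.
have [C C0 HC] := frac_maximal_dball alpha p q _ B w halpha0 halpha1 hp1 pq qE
  alphaq erefl hw B0 HB.
(* [C] is only known to be nonnegative, and adding 1 makes the constant positive. *)
exists (C `^ q^-1 + 1); split; first by rewrite ltr_wpDl ?powR_ge0.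
move=> x; rewrite /morrey /=.
set nx := morrey_norm p q _ _ _ => nxy.
have nx0 : (0 <= nx)%E by exact: morrey_norm_ge0.
have nxfin : nx \is a fin_num by rewrite ge0_fin_numE.
pose X := fine nx.
have X0 : 0 <= X by exact: fine_ge0.
have nxE : nx = X%:E by rewrite fineK.
have ball0 m N : 0 < wsum (wpow w q) (dball m N).
  rewrite /wsum (sum_dball _ (m - N%:Z) _ _ 0 (2 * N + 1)).
  - by apply: sum_nat_gt0 => [k|]; [exact: powR_gt0 | rewrite addn1].
  - by clear; lia.
  - by clear; lia.
have HX m N : (\sum_(k \in dball m N) `|x k| `^ p * wpow w p k) `^ p^-1
       <= X * wsum (wpow w q) (dball m N) `^ alpha.
  have := le_morrey_norm _ p q (wpow w p) (wpow w q) x m N.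
  rewrite -/nx nxE lee_fin pqE powRN mulrC ler_pdivrMr //.
  by rewrite powR_gt0.
rewrite nxE -EFinM; apply: ge_ereal_sup => _ [[m N] _ <-] /=.
have [c [c0 c1 c2]] := HC x X m N X0 HX.
set U := wsum (wpow w q) (dball m N) in c2 *.
have U0 : 0 < U by exact: ball0.
have fm0 k : (0 <= frac_maximal alpha x k)%E.
  apply: le_trans (ereal_sup_ubound _); last by exists 0%N.
  rewrite lee_fin mulr_ge0 ?invr_ge0 ?powR_ge0 //.
  by rewrite fsbig_finite ?sumr_ge0 //; exact: finite_dball.
have fmc k : dball m N k -> (frac_maximal alpha x k <= (c k)%:E)%E.
  by move=> kS; apply: ge_ereal_sup => _ [N' _ <-]; rewrite lee_fin c1.
have sum_le : (\sum_(k \in dball m N)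
    (poweR `|frac_maximal alpha x k| q * (wpow w q k)%:E) <=
    (C * X `^ q * U `^ (alpha * q))%:E)%E.
  apply: (@le_trans _ _ (\sum_(k \in dball m N) (c k `^ q * wpow w q k)%:E)%E).
    apply: lee_fsum => [|k kS]; first exact: finite_dball.
    rewrite EFinM lee_wpmul2r ?lee_fin ?powR_ge0 // -poweR_EFin.
    by rewrite gee0_abs // lee_poweRl ?fmc // ltW.
  by rewrite fsumEFin ?lee_fin //; exact: finite_dball.
have sum0 : (0 <= \sum_(k \in dball m N)
    (poweR `|frac_maximal alpha x k| q * (wpow w q k)%:E))%E.
  apply: fsume_ge0 => k _.
  by rewrite mule_ge0 ?poweR_ge0 // lee_fin powR_ge0.
apply: (@le_trans _ _ ((U `^ (s^-1 - q^-1))%:E *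
    poweR (C * X `^ q * U `^ (alpha * q))%:E q^-1)%E).
  rewrite lee_wpmul2l ?lee_fin ?powR_ge0 //.
  by rewrite lee_poweRl // invr_ge0 ltW.
(* The factor [U^(-alpha)] cancels the [q]-th root of [U^(alpha q)], which leaves [C^(1/q) X]. *)
rewrite poweR_EFin -EFinM lee_fin sE.
rewrite !powRM ?mulr_ge0 ?powR_ge0 // [U `^ (alpha * q)]powRrM !powRKV ?powR_ge0 //.
rewrite powRN mulrC mulfK ?gt_eqF ?powR_gt0 //.
by rewrite ler_wpM2r // lerDl.
Qed.
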